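(* Let $X$ be a Banach space with density character $\tau$ and let $E$ be a Banach space containing a $1$-equilateral set $A$ of cardinality $\tau$. Then $\mathcal{CR}(X,E)\ge1$.
   Context: The density character of $X$ is the smallest cardinality of a dense subset of $X$. For $\lambda>0$, a subset $A$ of a Banach space is $\lambda$-equilateral if $\|x-y\|=\lambda$ for all $x,y\in A$ with $x\ne y$. For metric spaces $(M_1,d_1)$, $(M_2,d_2)$ and an arbitrary (not necessarily continuous) map $\phi: M_1\to M_2$, define for $t\in(0,\infty)$ $$\kappa_\phi(t)=\inf_{d_1(x,y)\ge t} d_2(\phi(x),\phi(y)),\qquad \omega_\phi(t)=\sup_{d_1(x,y)\le t} d_2(\phi(x),\phi(y)),$$ with values in $[0,\infty]$, and $\kappa(\phi)=\sup_{t<\infty}\kappa_\phi(t)$, $\omega(\phi)=\inf_{t>0}\omega_\phi(t)$. The separation ratio of $\phi$ is $\mathcal{R}(\phi)=\kappa(\phi)/\omega(\phi)\in[0,\infty]$, with the conventions $\frac{a}{\infty}=\frac{0}{a}=0$ for all $a\in[0,\infty]$ and $\frac{a}{0}=\frac{\infty}{a}=\frac{\infty}{0}=\infty$ for all $a\in(0,\infty)$. The coarse embeddability ratio is $\mathcal{CR}(M_1,M_2)=\sup_\phi \mathcal{R}(\phi)$, the supremum over all maps $\phi:M_1\to M_2$. Banach spaces carry their norm metric. *)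

(* Defs.v *)
From HB Require Import structures.
From mathcomp Require Import all_boot all_order all_algebra.
From mathcomp Require Import all_classical all_reals all_analysis.

Set Implicit Arguments.
Unset Strict Implicit.
Unset Printing Implicit Defensive.

Import Order.TTheory GRing.Theory Num.Theory.
Import numFieldNormedType.Exports.

Local Open Scope classical_set_scope.
Local Open Scope card_scope.
Local Open Scope ring_scope.

(* A cardinal is represented by any set [tau] having that cardinality. *)
Definition has_density_character (X : topologicalType) (U : Type)
    (tau : set U) : Prop :=
  (exists2 D : set X, dense D & D #= tau) /\
  (forall D : set X, dense D -> tau #<= D).

Definition equilateral (R : realType) (E : normedModType R) (lambda : R)
    (A : set E) : Prop :=
  forall x y : E, A x -> A y -> x != y -> `|x - y| = lambda.

(* [normedModType] does not inherit from [metricType]; this alias of a normed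
   space carries the metric [`|x - y|]. *)
Definition norm_metric (R : realType) (X : normedModType R) : Type := X.

Section norm_metric_instance.
Context {R : realType} {X : normedModType R}.

Let dist (x y : norm_metric X) : R := `|(x : X) - (y : X)|.

HB.instance Definition _ := PseudoMetric.copy (norm_metric X) X.

Let dist_ge0 x y : 0 <= dist x y.
Proof. exact: normr_ge0. Qed.

Let dist_positivity x y : dist x y = 0 -> x = y.
Proof. by move=> /normr0_eq0 /eqP; rewrite subr_eq0 => /eqP. Qed.

Let ballEdist (x : norm_metric X) d : ball x d = [set y | dist x y < d].
Proof. by have /(congr1 (fun f => f x d)) <- := @ball_normE R X. Qed.

HB.instance Definition _ := @PseudoMetric_isMetric.Build R (norm_metric X)
  dist dist_ge0 dist_positivity ballEdist.

End norm_metric_instance.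

Lemma mdist_norm_metric (R : realType) (X : normedModType R) (x y : X) :
  mdist (x : norm_metric X) (y : norm_metric X) = `|x - y|.
Proof. by []. Qed.

Section separation_ratio.
Local Open Scope ereal_scope.
Context {R : realType} {M1 M2 : metricType R}.
Implicit Type phi : M1 -> M2.

(* The infimum of the empty set is [+oo], as it is in [0, +oo]. The supremum of
   the empty set is [-oo] instead of [0], which matters only if [M1] or [M2] is
   empty. *)
Definition kappa_at phi (t : R) : \bar R :=
  ereal_inf [set (mdist (phi p.1) (phi p.2))%:E
            | p in [set p : M1 * M1 | (t <= mdist p.1 p.2)%R]].

Definition omega_at phi (t : R) : \bar R :=
  ereal_sup [set (mdist (phi p.1) (phi p.2))%:E
            | p in [set p : M1 * M1 | (mdist p.1 p.2 <= t)%R]].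

Definition kappa phi : \bar R :=
  ereal_sup [set kappa_at phi t | t in [set t : R | (0 < t)%R]].

Definition omega phi : \bar R :=
  ereal_inf [set omega_at phi t | t in [set t : R | (0 < t)%R]].

(* Division in [\bar R] follows the intended conventions on [0, +oo]:
   see [ediv_conventions]. *)
Definition separation_ratio phi : \bar R := kappa phi / omega phi.

End separation_ratio.

Definition coarse_embeddability_ratio (R : realType) (M1 M2 : metricType R) :
    \bar R :=
  ereal_sup [set separation_ratio phi | phi in [set: M1 -> M2]].

Lemma ediv_conventions (R : realType) :
  [/\ forall a : \bar R, (0 <= a -> a / +oo = 0)%E,
      forall a : \bar R, (0 <= a -> 0 / a = 0)%E,
      forall a : R, 0 < a -> (a%:E / 0 = +oo)%E /\ (+oo / a%:E = +oo)%E,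
      ((+oo : \bar R) / 0 = +oo)%E &
      forall a b : R, 0 < b -> (a%:E / b%:E = (a / b)%:E)%E].
Proof.
split=> [a _|a _|a a0||a b b0].
- by rewrite invey mule0.
- by rewrite mul0e.
- split; first by rewrite inve0 gt0_muley ?lte_fin.
  by rewrite inver gt_eqF// gt0_mulye// lte_fin invr_gt0.
- by rewrite inve0 mulyy.
- by rewrite inver gt_eqF.
Qed.

(* Main.v *)
(** Sending each point of [X] to a point of a dense set at distance less than 1,
    and then injecting the dense set into [A], gives a map [phi] whose values
    are pairwise at distance 0 or 1, so [omega phi <= 1]. Points at distance at
    least 2 have different approximants, so [kappa phi >= 1]. *)

Require Import Defs.
From mathcomp Require Import all_boot all_order all_algebra.
From mathcomp Require Import all_classical all_reals all_analysis.

Import numFieldNormedType.Exports.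

Local Open Scope classical_set_scope.
Local Open Scope card_scope.
Local Open Scope ring_scope.

Import Order.TTheory GRing.Theory Num.Theory.

(** Every open ball of radius [e] meets [D], and choice picks a point in each. *)
Lemma dense_approximation (R : realType) (X : normedModType R) (D : set X)
    (e : R) : dense D -> 0 < e ->
  exists g : X -> X, forall x, D (g x) /\ `|x - g x| < e.
Proof.
move=> dD e0.
suff /choice[g gP] : forall x, exists y, D y /\ `|x - y| < e by exists g.
move=> x; have [y [/= xy Dy]] : ball x e `&` D !=set0.
  by apply: dD; [exists x; exact: ballxx|exact: ball_open].
by exists y; split; move: xy; rewrite // -ball_normE.
Qed.

(** The pair [(x, x)] is admissible at every scale. The point [x] rules out an empty [M1], where
    each [omega_at] would be the supremum of the empty set, [-oo]. *)
Lemma omega_ge0 (R : realType) (M1 M2 : metricType R) (phi : M1 -> M2) (x : M1) :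
  (0 <= omega phi)%E.
Proof.
apply: le_ereal_inf_tmp => _ [t t0 <-]; apply: ereal_sup_ubound.
by exists (x, x); rewrite /= mdistxx//; exact: ltW.
Qed.

Lemma omega_le (R : realType) (M1 M2 : metricType R) (phi : M1 -> M2) (c : R) :
  (forall x y, mdist (phi x) (phi y) <= c) -> (omega phi <= c%:E)%E.
Proof.
(* The bound on [phi] is uniform, so any positive scale would do in place of 1. *)
move=> phic; apply: (@le_trans _ _ (omega_at phi 1)).
  by apply: ereal_inf_lbound; exists 1 => /=.
by apply: ge_ereal_sup => _ [p _ <-]; rewrite lee_fin.
Qed.

Lemma kappa_ge (R : realType) (M1 M2 : metricType R) (phi : M1 -> M2) (t c : R) :
  0 < t ->
  (forall x y, t <= mdist x y -> c <= mdist (phi x) (phi y)) ->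
  (c%:E <= kappa phi)%E.
Proof.
move=> t0 phic; apply: (@le_trans _ _ (kappa_at phi t)).
  by apply: le_ereal_inf_tmp => _ [p tp <-]; rewrite lee_fin; exact: phic.
by apply: ereal_sup_ubound; exists t.
Qed.

Lemma lee1_div (R : realType) (a b : \bar R) :
  (1 <= a -> 0 <= b -> b <= 1 -> 1 <= a / b)%E.
Proof.
move=> a1 b0 b1; rewrite -[leLHS]mule1; apply: lee_pmul => //.
case: b b0 b1 => [b| |]//; rewrite !lee_fin => b0 b1.
(* The inverse of [0] is [+oo], so a vanishing denominator also gives a ratio at least 1. *)
rewrite inver; case: eqP => [_|/eqP bN0]; first exact: leey.
by rewrite lee_fin invf_ge1// lt_neqAle eq_sym bN0.
Qed.

Theorem proposition2p6 (R : realType) (X E : completeNormedModType R)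
    (U : Type) (tau : set U) (A : set E) :
  has_density_character X tau ->
  equilateral 1 A ->
  A #= tau ->
  (1 <= coarse_embeddability_ratio (norm_metric X) (norm_metric E))%E.
Proof.
move=> [[D dD Dtau] _] eqA Atau.
have /ppcard_leP[f] : D #<= A.
  by rewrite (card_le_eql Dtau) (card_le_eqr Atau) card_lexx.
have [g gP] := dense_approximation _ _ _ _ dD (@ltr01 R).
pose phi : norm_metric X -> norm_metric E := fun x => f (g x).
have Aphi x : A (f (g x)) by apply: funS; exact: (gP x).1.
apply: (@le_trans _ _ (separation_ratio phi)); last first.
  by apply: ereal_sup_ubound; exists phi.
apply: lee1_div.
(* The threshold 2 is twice the approximation radius: a common approximant would put [x] and [y] at
   distance strictly below 1 + 1. *)
- apply: (@kappa_ge _ _ _ _ 2) => // x y; rewrite !mdist_norm_metric => xy.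
  suff fxy : f (g x) != f (g y) by rewrite /phi eqA.
  apply/eqP => fxy.
  have gxy : g x = g y.
    (* [f] is injective only on [D], which contains all values of [g]. *)
    by apply: (@inj _ _ _ f); rewrite ?inE//; exact: (gP _).1.
  move: xy; rewrite leNgt => /negP; apply.
  rewrite (le_lt_trans (ler_distD (g x) x y))// [ltRHS](_ : _ = 1 + 1)//.
  by rewrite ltrD ?(gP x).2// gxy distrC (gP y).2.
- exact: (@omega_ge0 _ _ _ phi (0 : X)).
- apply: omega_le => x y; rewrite mdist_norm_metric /phi.
  have [->|fxy] := eqVneq (f (g x)) (f (g y)); first by rewrite subrr normr0.
  by rewrite eqA.
Qed.
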